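(* For every integer $n\ge 1$ and every integer $r\ge 0$, the layer $L_r(n)$ is invariant under conjugation: for every $\lambda\vdash n$, $$\lambda\in L_r(n)\iff \lambda'\in L_r(n).$$
   Context: $\mathrm{Par}(n)$ is the set of integer partitions of $n$; $\lambda\vdash n$ means $\lambda\in\mathrm{Par}(n)$; $\lambda'$ denotes the conjugate partition (transpose of the Young diagram). The partition graph $G_n$ is the simple graph with vertex set $\mathrm{Par}(n)$ in which two distinct partitions are adjacent if one is obtained from the other by an elementary transfer of one unit between two parts (decrease one part by $1$ and increase another part by $1$, where the increased part may be an empty part of size $0$, i.e. a new part of size $1$ may be created, and a part that becomes $0$ is deleted), followed by reordering. $K_n$ is the clique complex of $G_n$: its simplices are the nonempty cliques $\sigma$ of $G_n$, with $\dim\sigma=|\sigma|-1$. The local simplex dimension of $\lambda\vdash n$ is $\mathrm{dim}_{\mathrm{loc}}(\lambda)=\max\{\dim\sigma:\sigma\text{ a simplex of }K_n,\ \lambda\in\sigma\}$. For $r\ge 0$ the $r$-th simplex layer is $L_r(n)=\{\lambda\vdash n:\mathrm{dim}_{\mathrm{loc}}(\lambda)=r\}$. *)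

(* Defs.v *)
(* Mathematical Components *)
From HB Require Import structures.
From mathcomp Require Import all_boot.

Set Implicit Arguments.
Unset Strict Implicit.
Unset Printing Implicit Defensive.

Definition is_part (n : nat) (s : seq nat) : bool :=
  [&& sorted geq s, 0 \notin s & sumn s == n].

Record partition_of (n : nat) : Type :=
  Partition { parts :> seq nat; partsP : is_part n parts }.

HB.instance Definition _ n := [isSub for @parts n].
HB.instance Definition _ n := [Countable of partition_of n by <:].

(* Finiteness of Par(n): at most n parts, each at most n. *)
Section Finiteness.
Variable n : nat.

Lemma leq_nth_sumn (s : seq nat) i : nth 0 s i <= sumn s.
Proof.
elim: s i => [|x s IHs] [|i] //=; first exact: leq_addr.
exact: leq_trans (IHs i) (leq_addl _ _).
Qed.

Lemma size_part_leq (s : seq nat) : 0 \notin s -> size s <= sumn s.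
Proof.
elim: s => //= x s IHs; rewrite inE negb_or eq_sym -lt0n => /andP[x0 /IHs hs].
by rewrite -add1n leq_add.
Qed.

Definition part_code (l : partition_of n) : {ffun 'I_n -> 'I_n.+1} :=
  [ffun i : 'I_n => inord (nth 0 (parts l) i)].

Definition part_decode (f : {ffun 'I_n -> 'I_n.+1}) : option (partition_of n) :=
  insub [seq x <- [seq val (f i) | i <- enum 'I_n] | x != 0].

Lemma part_codeK : pcancel part_code part_decode.
Proof.
move=> l; rewrite /part_decode.
suff -> : [seq x <- [seq val (part_code l i) | i <- enum 'I_n] | x != 0]
          = parts l by rewrite valK.
have /and3P[_ l0 /eqP ln] := partsP l.
have sz : size (parts l) <= n by rewrite -{2}ln size_part_leq.
have -> : [seq val (part_code l i) | i <- enum 'I_n]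
          = parts l ++ nseq (n - size (parts l)) 0.
  apply: (@eq_from_nth _ 0) => [|i].
    by rewrite size_map size_enum_ord size_cat size_nseq subnKC.
  rewrite size_map size_enum_ord => lt_in.
  rewrite (nth_map (Ordinal lt_in)) ?size_enum_ord // ffunE /=.
  rewrite inordK ?nth_enum_ord ?ltnS // -?[X in _ <= X]ln ?leq_nth_sumn //.
  by rewrite nth_cat nth_nseq if_same; case: ltnP => // /(nth_default 0).
rewrite filter_cat filter_nseq /= cats0; apply/all_filterP/allP => x xl.
by apply: contraNneq l0 => <-.
Qed.

End Finiteness.

HB.instance Definition _ n : isFinite (partition_of n) :=
  PCanIsFinite (@part_codeK n).

(* The number of parts exceeding j, for each j below the largest part;
   [conj_seq_diagram] shows that this transposes the Young diagram
   {(i, j) | j < nth 0 s i}. *)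
Definition conj_seq (s : seq nat) : seq nat :=
  mkseq (fun j => count (ltn j) s) (head 0 s).

Lemma geq_trans : transitive geq.
Proof. by move=> y x z /= yx zy; exact: leq_trans zy yx. Qed.

Lemma all_leq_head (s : seq nat) : sorted geq s -> all (geq (head 0 s)) s.
Proof.
by case: s => //= x s; rewrite leqnn /= => /(order_path_min geq_trans).
Qed.

Lemma conj_seq_diagram (s : seq nat) i j :
  sorted geq s -> (i < nth 0 (conj_seq s) j) = (j < nth 0 s i).
Proof.
move=> ss.
have E : nth 0 (conj_seq s) j = count (ltn j) s.
  have [lt_j | le_j] := ltnP j (head 0 s); first by rewrite nth_mkseq.
  rewrite nth_default ?size_mkseq //; apply/esym/eqP.
  rewrite -leqn0 leqNgt -has_count -all_predC.
  by apply: sub_all (all_leq_head ss) => x /= /leq_trans-/(_ _ le_j); rewrite -leqNgt.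
rewrite {}E; elim: s i ss => [|x s IHs] i; first by rewrite nth_nil.
move=> xs; have ss : sorted geq s := path_sorted xs.
rewrite [count _ _]/=.
have [lt_jx | le_xj] := ltnP j x.
  by case: i => [|i] /=; rewrite ?lt_jx ?add1n ?ltnS ?IHs.
rewrite add0n; have -> : count (ltn j) s = 0.
  apply/eqP; rewrite -leqn0 leqNgt -has_count -all_predC.
  apply: sub_all (order_path_min geq_trans xs) => y /= yx.
  by rewrite -leqNgt (leq_trans yx).
apply/esym/negbTE; rewrite -leqNgt.
case: i => [|i] //=.
have [lt_i | ] := ltnP i (size s); last by move=> /(nth_default 0)->.
have /allP/(_ _ (mem_nth 0 lt_i)) /= := order_path_min geq_trans xs.
by move=> /leq_trans; apply.
Qed.

Lemma sumn_conj_seq (s : seq nat) : sorted geq s -> sumn (conj_seq s) = sumn s.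
Proof.
move=> /all_leq_head; rewrite /conj_seq; move: (head 0 s) => m.
have -> : sumn (mkseq (fun j => count (ltn j) s) m)
          = \sum_(0 <= j < m) count (ltn j) s.
  by rewrite sumnE big_map /index_iota subn0.
elim: s => [|x s IHs] /=; first by rewrite big1.
move=> /andP[xm /IHs {}IHs]; rewrite big_split /= IHs; congr (_ + _).
rewrite (big_cat_nat (leq0n x) xm) /= [X in _ + X]big_nat_cond [X in _ + X]big1 => [|j].
  rewrite addn0 big_nat_cond (eq_bigr (fun=> 1)) => [|j].
    by rewrite -big_nat_cond sum_nat_const_nat subn0 muln1.
  by rewrite andbT /= => ->.
by rewrite andbT => /andP[xj _]; rewrite ltnNge xj.
Qed.

Lemma conj_seqP n (l : partition_of n) : is_part n (conj_seq (parts l)).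
Proof.
have /and3P[ls l0 /eqP ln] := partsP l; apply/and3P; split.
- apply: (@homo_sorted _ _ _ leq) (iota_sorted 0 _) => i j /= le_ij.
  by apply: sub_count => x /=; apply: leq_ltn_trans.
- apply/mapP => -[j]; rewrite mem_iota /= add0n => lt_j /eqP.
  rewrite eq_sym -leqn0 leqNgt -has_count.
  by case: (parts l) lt_j => //= x s ->.
- by rewrite sumn_conj_seq ?ln.
Qed.

Definition conj_part n (l : partition_of n) : partition_of n :=
  Partition (conj_seqP l).

(* One unit moves from the part at position i to the one at position j;
   j = size s is the empty part, which [incr_nth] appends. *)
Definition transfer (s : seq nat) (i j : nat) : seq nat :=
  sort geq [seq x <- incr_nth (set_nth 0 s i (nth 0 s i).-1) j | x != 0].

Definition is_transfer n (l m : partition_of n) : bool :=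
  [exists i : 'I_(size l), exists j : 'I_(size l).+1,
     (i != j :> nat) && (parts m == transfer l i j)].

Definition padj n : rel (partition_of n) :=
  fun l m => (l != m) && (is_transfer l m || is_transfer m l).

Section CliqueComplex.
Variables (V : finType) (e : rel V).

Definition clique (S : {set V}) : bool :=
  [forall x in S, forall y in S, (x != y) ==> e x y].

Definition simplex (S : {set V}) : bool := (S != set0) && clique S.

Definition dim (S : {set V}) : nat := #|S|.-1.

(* The maximum is over a nonempty family, as it contains [set x]. *)
Definition dim_loc (x : V) : nat :=
  \max_(S : {set V} | simplex S && (x \in S)) dim S.

End CliqueComplex.

Definition layer (r n : nat) : {set partition_of n} :=
  [set l | dim_loc (@padj n) l == r].

(* Main.v *)
(* Conjugation is an involutive automorphism of the partition graph, so it
   permutes the cliques and preserves the local simplex dimension.  It preserves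
   adjacency because, moving one unit from a part a to a part b, the number of
   parts exceeding k drops by 1 for k = a - 1, grows by 1 for k = b, and is
   otherwise unchanged: the conjugate undergoes the transfer from column a - 1
   to column b, and a - 1 <> b when the partition actually changes. *)
Require Import Defs.
From mathcomp Require Import all_boot.
From mathcomp Require Import zify.

Lemma incr_nth_set_nth (s : seq nat) j :
  incr_nth s j = set_nth 0 s j (nth 0 s j).+1.
Proof.
by elim: s j => [|x s IHs] [|j] //=; rewrite ?IHs // nth_nil.
Qed.

Lemma nth_lt_count (s : seq nat) i k : (k < nth 0 s i) <= count (ltn k) s.
Proof.
case: (ltnP k _) => // lt_k; rewrite -has_count.
apply/hasP; exists (nth 0 s i) => //; apply: mem_nth.
by case: (ltnP i (size s)) lt_k => // /(nth_default 0)->.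
Qed.

(** Sorting and deleting zeros leave the number of parts above [k] unchanged, so only the two
    modified entries matter. *)
Lemma count_ltn_transfer (s : seq nat) i j k : 0 < nth 0 s i -> i != j ->
  count (ltn k) (transfer s i j) + ((nth 0 s i).-1 == k)
  = count (ltn k) s + (nth 0 s j == k).
Proof.
move=> si ij; rewrite /transfer count_sort count_filter.
rewrite (@eq_count _ _ (ltn k)) => [|x /=]; last by case: x => [|x]; rewrite ?andbT.
(* [count_set_nthF] uses truncated subtraction; these two bounds make it exact for [lia]. *)
have := nth_lt_count s i k.
have := nth_lt_count (set_nth 0 s i (nth 0 s i).-1) j k.
rewrite incr_nth_set_nth !count_set_nthF // !nth_set_nth /= eq_sym (negbTE ij).
lia.
Qed.

Lemma nth_conj_seq (s : seq nat) k :
  sorted geq s -> nth 0 (conj_seq s) k = count (ltn k) s.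
Proof.
move=> /all_leq_head/allP s_le; have [lt_k | le_k] := ltnP k (head 0 s).
  by rewrite nth_mkseq.
rewrite nth_default ?size_mkseq //; apply/esym/eqP; rewrite -leqn0 leqNgt -has_count.
by apply/hasPn => x /s_le /= x_le; rewrite -leqNgt (leq_trans x_le).
Qed.

(** With default 0, the hypothesis makes [s] equal to [t] followed by zeros only. *)
Lemma filter_neq0_nth (s t : seq nat) :
  0 \notin t -> nth 0 s =1 nth 0 t -> [seq x <- s | x != 0] = t.
Proof.
elim: s t => [|x s IHs] [|y t] //=.
- by rewrite inE negb_or => /andP[/eqP y0 _] /(_ 0) /= /y0.
- by move=> t0 E; have /= -> := E 0; apply: IHs => // k; rewrite nth_nil; apply: (E k.+1).
rewrite inE negb_or eq_sym => /andP[y0 t0] E.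
by have /= -> := E 0; rewrite y0 (IHs t) // => k; apply: (E k.+1).
Qed.

Lemma partition_of_nth_inj n (l m : partition_of n) : nth 0 l =1 nth 0 m -> l = m.
Proof.
move=> E; apply: val_inj => /=.
have /and3P[_ l0 _] := partsP l; have /and3P[_ m0 _] := partsP m.
by rewrite -(filter_neq0_nth _ _ l0 (frefl _)) (filter_neq0_nth _ _ m0 E).
Qed.

Lemma conj_partK n : involutive (@conj_part n).
Proof.
move=> l; apply: partition_of_nth_inj => i.
have /and3P[ls _ _] := partsP l; have /and3P[cs _ _] := partsP (conj_part l).
have E k : (k < nth 0 (conj_part (conj_part l)) i) = (k < nth 0 l i).
  by rewrite /= !conj_seq_diagram.
(* Taking [k] to be each of the two entries in [E] gives both inequalities. *)
by apply/eqP; rewrite eqn_leq leqNgt E ltnn /= leqNgt -E ltnn.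
Qed.

(** Since [m] is already sorted, the sort in [transfer] does nothing, and a transfer can be checked
    position by position. *)
Lemma nth_is_transfer n (l m : partition_of n) i j : i != j ->
  (forall k, nth 0 m k + (i == k) = nth 0 l k + (j == k)) -> is_transfer l m.
Proof.
move=> ij E; have /and3P[ls l0 _] := partsP l; have /and3P[ms m0 _] := partsP m.
have li : 0 < nth 0 l i by have := E i; rewrite eqxx eq_sym (negbTE ij); lia.
have lt_i : i < size l by case: (ltnP i (size l)) li => // /(nth_default 0)->.
have lt_j : j < (size l).+1.
  (* A unit placed beyond the first empty position would leave a 0 before a 1 in [m], which is
     sorted. *)
  rewrite ltnS leqNgt; apply/negP; case: j ij E => [//|j] ij E lt_j.
  have [lj lj1] : nth 0 l j = 0 /\ nth 0 l j.+1 = 0.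
    by split; apply: nth_default; rewrite ?(ltnW lt_j).
  have ij' : i != j by apply: contraTneq li => ->; rewrite lj.
  have mj : nth 0 m j.+1 <= nth 0 m j.
    have [lt_m | le_m] := ltnP j.+1 (size m); last by rewrite (nth_default 0 le_m).
    exact: (sortedP 0 ms).
  by have := E j.+1; have := E j; lia.
apply/existsP; exists (Ordinal lt_i).
apply/existsP; exists (Ordinal lt_j).
rewrite /= ij /= /transfer (filter_neq0_nth _ m) //.
  by rewrite (sorted_sort geq_trans).
move=> k; have := E k; rewrite nth_incr_nth nth_set_nth /= (eq_sym k).
by have [<-|_] := eqVneq i k; lia.
Qed.

Lemma conj_is_transfer n (l m : partition_of n) :
  l != m -> is_transfer l m -> is_transfer (conj_part l) (conj_part m).
Proof.
move=> lm /existsP[i /existsP[j /andP[ij /eqP E]]].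
have /and3P[ls l0 _] := partsP l; have /and3P[ms m0 _] := partsP m.
have li : 0 < nth 0 l i.
  by rewrite lt0n; apply: contraNneq l0 => <-; apply: mem_nth.
have C k : nth 0 (conj_part m) k + ((nth 0 l i).-1 == k)
         = nth 0 (conj_part l) k + (nth 0 l j == k).
  by rewrite /= !nth_conj_seq // {1}E count_ltn_transfer.
(* If the two columns coincide, the corrections in [C] cancel, so the conjugates agree and hence
   [l = m]. *)
apply: (nth_is_transfer _ _ _ _ _ _ C); apply: contraNneq lm => ab.
rewrite -(inj_eq (inv_inj (@conj_partK n))); apply/eqP/partition_of_nth_inj => k.
by have := C k; rewrite ab => /addIn.
Qed.

Lemma conj_padj n (l m : partition_of n) :
  padj l m -> padj (conj_part l) (conj_part m).
Proof.
move=> /andP[lm adj]; rewrite /padj (inj_eq (inv_inj (@conj_partK n))) lm /=.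
case/orP: adj => adj; first by rewrite conj_is_transfer.
by rewrite (conj_is_transfer _ _ _ _ adj) ?orbT // eq_sym.
Qed.

(** The image of a simplex through [x] is a simplex through [f x], of the same cardinality by
    injectivity. *)
Lemma dim_loc_inj_homo (V W : finType) (e : rel V) (e' : rel W) (f : V -> W) x :
  injective f -> {homo f : u v / e u v >-> e' u v} ->
  dim_loc e x <= dim_loc e' (f x).
Proof.
move=> f_inj f_homo; apply/bigmax_leqP => S /andP[/andP[S0 /forall_inP Sc] Sx].
rewrite /dim -(card_imset S f_inj); apply: (leq_bigmax_cond (f @: S)).
rewrite (imset_f f Sx) andbT; apply/andP; split.
  by apply/set0Pn; exists (f x); rewrite imset_f.
apply/forall_inP => _ /imsetP[u Su ->]; apply/forall_inP => _ /imsetP[v Sv ->].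
apply/implyP; rewrite (inj_eq f_inj) => uv; apply: f_homo.
by have /forall_inP/(_ v Sv)/implyP := Sc u Su; apply.
Qed.

Theorem corollary3p7 (n r : nat) (hn : 1 <= n) (l : partition_of n) :
  l \in layer r n <-> conj_part l \in layer r n.
Proof.
have le_conj m : dim_loc (@padj n) m <= dim_loc (@padj n) (conj_part m).
  by apply: (dim_loc_inj_homo _ _ _ _ _ _ (inv_inj (@conj_partK n)) (@conj_padj n)).
suff E : dim_loc (@padj n) (conj_part l) = dim_loc (@padj n) l.
  by rewrite !inE E.
(* The reverse inequality is [le_conj] at [conj_part l], whose conjugate is [l]. *)
by apply/eqP; rewrite eqn_leq le_conj -{2}(conj_partK _ l) le_conj.
Qed.
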